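(* Let $G:=G_1\times_{\mathcal{M}}G_2$ be a polynomial gluing with gluing isomorphism $\psi:\mathbb{F}[V]\to\mathbb{F}[V]^{\mathcal{M}}$, where $V=W_1\oplus W_2$. Suppose $\{u_1,\ldots,u_k\}$ is a generating set for the image of $\mathrm{Tr}^{G_1}$ (an ideal of $\mathbb{F}[W_1]^{G_1}$), $\{v_1,\ldots,v_s\}$ is a generating set for the image of $\mathrm{Tr}^{G_2}$ (an ideal of $\mathbb{F}[W_2]^{G_2}$), and $\tau\in\mathbb{F}[V]^{G_1\times G_2}$ is a generator for the image of $\mathrm{Tr}^{\mathcal{M}}$ (an ideal of $\mathbb{F}[V]^{\mathcal{M}}$). Then the image of $\mathrm{Tr}^{G}$ is the ideal of $\mathbb{F}[V]^G$ generated by $\{\tau\,\psi(u_iv_j)\mid 1\leq i\leq k,\ 1\leq j\leq s\}$.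
   Context: $\mathbb{F}$ is a field of prime characteristic $p$; $W_1,W_2$ are finite dimensional representations over $\mathbb{F}$ of finite groups $G_1,G_2$. For a representation $U$ of a group $H$, $H$ acts on the right on $U^*$ by $(\phi\cdot h)(u)=\phi(h\cdot u)$, and this extends to an action by $\mathbb{F}$-algebra automorphisms on the symmetric algebra $\mathbb{F}[U]$ of $U^*$; $\mathbb{F}[U]^H$ is the ring of invariants. For $H$ finite, the transfer is $\mathrm{Tr}^H:\mathbb{F}[U]\to\mathbb{F}[U]^H$, $\mathrm{Tr}^H(f)=\sum_{h\in H}f\cdot h$; its image is an ideal of $\mathbb{F}[U]^H$. Gluing: $\mathrm{Hom}_{\mathbb{F}}(W_2,W_1)$ carries a left $G_1$-action and right $G_2$-action, $(g_1\cdot\varphi\cdot g_2)(v)=g_1\cdot\varphi(g_2\cdot v)$. Let $\mathcal{M}\subseteq\mathrm{Hom}_{\mathbb{F}}(W_2,W_1)$ be a finite additive subgroup closed under both actions. The gluing $G_1\times_{\mathcal{M}}G_2$ is the group of triples $(g_1,\varphi,g_2)\in G_1\times\mathcal{M}\times G_2$ with product $(g_1,\varphi,g_2)(g_1',\varphi',g_2')=(g_1g_1',\,g_1\varphi'+\varphi g_2',\,g_2g_2')$. It acts on $V:=W_1\oplus W_2$ by $(g_1,\varphi,g_2)(w_1\oplus w_2)=(g_1w_1+\varphi(w_2))\oplus g_2w_2$. The subgroup $\mathcal{M}=\{(1,\varphi,1)\}$ is normal with quotient $G_1\times G_2$, which therefore acts on $\mathbb{F}[V]^{\mathcal{M}}$;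 also $G_1\times G_2=\{(g_1,0,g_2)\}$ is a subgroup acting on $V$ and on $\mathbb{F}[V]=\mathbb{F}[W_1\oplus W_2]$. The gluing is polynomial if there is a $(G_1\times G_2)$-equivariant $\mathbb{F}$-algebra isomorphism $\psi:\mathbb{F}[W_1\oplus W_2]\to\mathbb{F}[V]^{\mathcal{M}}$ (not necessarily degree preserving); such a $\psi$ is called a gluing isomorphism. $\mathbb{F}[W_i]$ is identified with the obvious subalgebra of $\mathbb{F}[V]=\mathbb{F}[W_1]\otimes\mathbb{F}[W_2]$. *)

(* Defs.v *)
From HB Require Import structures.
From mathcomp Require Import all_boot all_order all_fingroup all_algebra.
From mathcomp Require Import mxrepresentation.
From mathcomp Require Export finmap.
From mathcomp Require Export mpoly.

Set Implicit Arguments.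
Unset Strict Implicit.
Unset Printing Implicit Defensive.

Import GRing.Theory.
Local Open Scope fset_scope.
Local Open Scope ring_scope.

(* A finite group acts on the left on column vectors by [g . w = rG g *m w];
   [{mpoly F[n]}] is the symmetric algebra of the dual of ['cV[F]_n], with
   ['X_i] the i-th coordinate function. *)

Section Invariants.
Variables (F : fieldType) (gT : finGroupType) (n : nat).
Variable rG : mx_representation F [set: gT] n.
Implicit Types (f : {mpoly F[n]}) (H : {set gT}).

(* The right action [(f . h)(w) = f(h . w)]: the i-th coordinate function is
   sent to [w |-> (h . w)_i = \sum_j (rG h)_ij w_j]. *)
Definition mpact (h : gT) f : {mpoly F[n]} :=
  f \mPo [tuple \sum_(j < n) rG h i j *: 'X_j | i < n].

Lemma mpact_eval h f (w : 'cV[F]_n) :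
  (mpact h f).@[fun i => w i 0] = f.@[fun i => (rG h *m w) i 0].
Proof.
rewrite comp_mpoly_meval; apply: meval_eq => i.
rewrite tnth_mktuple mxE raddf_sum; apply: eq_bigr => j _.
by rewrite /= mevalZ mevalXU.
Qed.

Lemma mpactM g h f : mpact (g * h)%g f = mpact h (mpact g f).
Proof.
rewrite /mpact [LHS]comp_mpolyEX [X in _ = X \mPo _]comp_mpolyEX raddf_sum.
apply: eq_bigr => m _; rewrite /= comp_mpolyZ !comp_mpolyX rmorph_prod.
congr (_ *: _); apply: eq_bigr => i _; rewrite rmorphXn !tnth_mktuple /=.
congr (_ ^+ _); rewrite repr_mxM ?inE // raddf_sum /=.
transitivity (\sum_j \sum_k (rG g i k * rG h k j) *: ('X_j : {mpoly F[n]})).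
  by apply: eq_bigr => j _; rewrite mxE scaler_suml.
rewrite exchange_big; apply: eq_bigr => k _.
rewrite comp_mpolyZ comp_mpolyXU -tnth_nth tnth_mktuple scaler_sumr.
by apply: eq_bigr => j _; rewrite scalerA.
Qed.

Definition invariants H : {pred {mpoly F[n]}} :=
  fun f => [forall h in H, mpact h f == f].

Definition transfer H f : {mpoly F[n]} := \sum_(h in H) mpact h f.

Definition transfer_image H f : Prop := exists f', f = transfer H f'.

End Invariants.

(* [I] is the ideal of the subring [A] generated by the finite family [u] of
   elements of [A]. *)
Definition generates (R : nzRingType) (A : {pred R}) (J : finType) (u : J -> R)
    (I : R -> Prop) : Prop :=
  (forall j, u j \in A) /\
  (forall f, I f <->
     exists2 a : J -> R, (forall j, a j \in A) & f = \sum_j a j * u j).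

Section Gluing.
Variables (F : fieldType) (G1 G2 : finGroupType) (n1 n2 : nat).
Variables (r1 : mx_representation F [set: G1] n1).
Variables (r2 : mx_representation F [set: G2] n2).

(* [W_i = 'cV[F]_(n_i)], so that Hom(W_2, W_1) is ['M[F]_(n1, n2)]. *)
Record glue_module := GlueModule {
  glue_set :> {fset 'M[F]_(n1, n2)};
  glue0 : 0 \in glue_set;
  glueB : {in glue_set &, forall a b, a - b \in glue_set};
  glueL : forall g, {in glue_set, forall a, r1 g *m a \in glue_set};
  glueR : forall g, {in glue_set, forall a, a *m r2 g \in glue_set}
}.

Variable M : glue_module.

Record gluing := Gluing { glue1 : G1; glue_hom : M; glue2 : G2 }.

Definition gluing_val (x : gluing) : G1 * M * G2 :=
  (glue1 x, glue_hom x, glue2 x).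
Definition val_gluing (t : G1 * M * G2) : gluing :=
  Gluing t.1.1 t.1.2 t.2.
Lemma gluing_valK : cancel gluing_val val_gluing. Proof. by case. Qed.

HB.instance Definition _ := Equality.copy gluing (can_type gluing_valK).
HB.instance Definition _ := Choice.copy gluing (can_type gluing_valK).
HB.instance Definition _ := Countable.copy gluing (can_type gluing_valK).
HB.instance Definition _ := Finite.copy gluing (can_type gluing_valK).

Lemma glueN a : a \in glue_set M -> - a \in glue_set M.
Proof. by move=> aM; rewrite -sub0r glueB ?glue0. Qed.

Lemma glueD a b : a \in glue_set M -> b \in glue_set M -> a + b \in glue_set M.
Proof. by move=> aM bM; rewrite -[b]opprK glueB ?glueN. Qed.

Definition glue_zero : M := [` glue0 M].

Fact gluing_mul_subproof (x y : gluing) :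
  r1 (glue1 x) *m val (glue_hom y) + val (glue_hom x) *m r2 (glue2 y)
    \in glue_set M.
Proof. by rewrite glueD ?glueL ?glueR ?fsvalP. Qed.

Fact gluing_inv_subproof (x : gluing) :
  - (r1 (glue1 x)^-1%g *m val (glue_hom x) *m r2 (glue2 x)^-1%g) \in glue_set M.
Proof. by rewrite glueN ?glueR ?glueL ?fsvalP. Qed.

Definition gluing_mul (x y : gluing) : gluing :=
  Gluing (glue1 x * glue1 y)%g [` gluing_mul_subproof x y]
         (glue2 x * glue2 y)%g.
Definition gluing_one : gluing := Gluing 1%g glue_zero 1%g.
Definition gluing_inv (x : gluing) : gluing :=
  Gluing (glue1 x)^-1%g [` gluing_inv_subproof x] (glue2 x)^-1%g.

Lemma gluing_eq (x y : gluing) :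
  glue1 x = glue1 y -> val (glue_hom x) = val (glue_hom y) ->
  glue2 x = glue2 y -> x = y.
Proof. by case: x y => [a b c] [a' b' c'] /= -> /val_inj -> ->. Qed.

Lemma gluing_mulA : associative gluing_mul.
Proof.
move=> x y z; apply: gluing_eq; rewrite /= ?mulgA //.
by rewrite !repr_mxM ?inE // mulmxDr mulmxDl !mulmxA addrA.
Qed.

Lemma gluing_mul1 : left_id gluing_one gluing_mul.
Proof.
move=> x; apply: gluing_eq; rewrite /= ?mul1g //.
by rewrite repr_mx1 mul1mx mul0mx addr0.
Qed.

Lemma gluing_mulV : left_inverse gluing_one gluing_inv gluing_mul.
Proof.
move=> x; apply: gluing_eq; rewrite /= ?mulVg //.
by rewrite mulNmx repr_mxKV ?inE // subrr.
Qed.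

HB.instance Definition _ :=
  Finite_isGroup.Build gluing gluing_mulA gluing_mul1 gluing_mulV.

(* [V = W_1 (+) W_2 = 'cV[F]_(n1 + n2)], with [w_1 (+) w_2 = col_mx w1 w2]. *)
Definition gluing_mx (x : gluing) : 'M[F]_(n1 + n2) :=
  block_mx (r1 (glue1 x)) (val (glue_hom x)) 0 (r2 (glue2 x)).

Lemma gluing_mx_repr : mx_repr [set: gluing] gluing_mx.
Proof.
split=> [|x y _ _]; first by rewrite /gluing_mx /= !repr_mx1 -scalar_mx_block.
rewrite /gluing_mx mulmx_block /= !repr_mxM ?inE //.
by rewrite !mul0mx !mulmx0 !addr0 !add0r.
Qed.

Definition gluing_repr : mx_representation F [set: gluing] (n1 + n2) :=
  MxRepresentation gluing_mx_repr.

Definition gluing_kernel : {set gluing} :=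
  [set Gluing 1%g phi 1%g | phi : M].

Definition gluing_pair (g1 : G1) (g2 : G2) : gluing := Gluing g1 glue_zero g2.

Definition gluing_factors : {set gluing} :=
  [set gluing_pair g.1 g.2 | g : G1 * G2].

(* The quotient [G1 x G2] of the gluing by [gluing_kernel] acts on the
   invariants of the kernel through any lift; [gluing_pair g1 g2] is a lift of
   [(g1, g2)]. *)
Record gluing_isomorphism
    (psi : {lrmorphism {mpoly F[n1 + n2]} -> {mpoly F[n1 + n2]}}) : Prop := {
  gluing_iso_inj : injective psi;
  gluing_iso_img : forall f,
    f \in invariants gluing_repr gluing_kernel <-> exists f', f = psi f';
  gluing_iso_equivariant : forall g1 g2 f,
    psi (mpact gluing_repr (gluing_pair g1 g2) f)
    = mpact gluing_repr (gluing_pair g1 g2) (psi f)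
}.

End Gluing.

(* The inclusions of [F[W_1]] and [F[W_2]] in [F[W_1 (+) W_2]]. *)
Definition mpolyl (F : fieldType) (n1 n2 : nat) (f : {mpoly F[n1]}) :
    {mpoly F[n1 + n2]} :=
  f \mPo [tuple 'X_(lshift n2 i) | i < n1].

Definition mpolyr (F : fieldType) (n1 n2 : nat) (f : {mpoly F[n2]}) :
    {mpoly F[n1 + n2]} :=
  f \mPo [tuple 'X_(rshift n1 i) | i < n2].

(* Main.v *)
From HB Require Import structures.
Require Import Defs.
From mathcomp Require Import all_boot all_order all_fingroup all_algebra.
From mathcomp Require Import mxrepresentation.

Set Implicit Arguments.
Unset Strict Implicit.
Unset Printing Implicit Defensive.

Import GRing.Theory.
Local Open Scope ring_scope.

(** The transfer of the gluing factors as Tr^G = Tr^(G1 x G2) o Tr^M.  Since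
    Im Tr^M consists of the elements tau * psi b, and since tau is invariant
    and psi equivariant under G1 x G2, this yields
    Im Tr^G = tau * psi (Im Tr^(G1 x G2)).  On F[V] = F[W1] (x) F[W2] the
    transfer of G1 x G2 is the tensor product of the transfers of G1 and G2, so
    its image is generated by the u_i v_j, and psi maps F[V]^(G1 x G2) onto
    F[V]^G. *)

(** An algebra morphism out of a substitution is determined by its values on the substituted
    polynomials. *)
Lemma lrmorph_comp_mpoly (F : comNzRingType) (n k l : nat)
    (phi : {lrmorphism {mpoly F[k]} -> {mpoly F[l]}})
    (q : n.-tuple {mpoly F[k]}) (f : {mpoly F[n]}) :
  phi (f \mPo q) = f \mPo [tuple phi (tnth q i) | i < n].
Proof.
rewrite !comp_mpolyE raddf_sum; apply: eq_bigr => m _ /=.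
rewrite linearZ rmorph_prod; congr (_ *: _); apply: eq_bigr => i _.
by rewrite rmorphXn tnth_mktuple.
Qed.

Lemma comp_mpolyA (F : comNzRingType) (n k l : nat)
    (f : {mpoly F[n]}) (q : n.-tuple {mpoly F[k]}) (r : k.-tuple {mpoly F[l]}) :
  (f \mPo q) \mPo r = f \mPo [tuple tnth q i \mPo r | i < n].
Proof. exact: (lrmorph_comp_mpoly (comp_mpoly r)). Qed.

(** Kronecker delta coefficients lie in any subring. Used to write each [u i] and [v j] as a
    transfer. *)
Lemma generates_mem (R : nzRingType) (A : subringClosed R) (J : finType)
    (u : J -> R) (I : R -> Prop) :
  generates A u I -> forall j, I (u j).
Proof.
move=> [_ uI] j; apply/uI; exists (fun i => (i == j)%:R).
  by move=> i; rewrite rpred_nat.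
rewrite (bigD1 j) //= eqxx mul1r big1 ?addr0 // => i /negPf->.
by rewrite mul0r.
Qed.

(** * Invariants and transfer for one representation *)

Section Transfer.
Variables (F : fieldType) (gT : finGroupType) (n : nat).
Variable rG : mx_representation F [set: gT] n.
Implicit Types (f : {mpoly F[n]}) (H : {set gT}).

HB.instance Definition _ h := GRing.LRMorphism.copy (mpact rG h)
  (comp_mpoly [tuple \sum_(j < n) rG h i j *: 'X_j | i < n]).

Lemma invariantsP H f :
  reflect {in H, forall h, mpact rG h f = f} (f \in invariants rG H).
Proof. exact: eqfun_inP. Qed.

Fact invariants_subring H : subring_closed (invariants rG H).
Proof.
split=> [|f f' /invariantsP fP /invariantsP f'P
         |f f' /invariantsP fP /invariantsP f'P]; apply/invariantsP => h hH.
- exact: rmorph1.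
- by rewrite rmorphB /= fP ?f'P.
- by rewrite rmorphM /= fP ?f'P.
Qed.

HB.instance Definition _ H :=
  GRing.isSubringClosed.Build {mpoly F[n]} (invariants rG H)
    (invariants_subring H).

Lemma transfer_is_semilinear H : semilinear (transfer rG H).
Proof.
split=> [a f|f f']; rewrite /transfer.
  by rewrite scaler_sumr; apply: eq_bigr => h _; rewrite linearZ.
by rewrite -big_split; apply: eq_bigr => h _; rewrite raddfD.
Qed.

HB.instance Definition _ H :=
  GRing.isSemilinear.Build F {mpoly F[n]} {mpoly F[n]} _ (transfer rG H)
    (transfer_is_semilinear H).

(** Linearity over the invariants: this is what makes the image of the transfer an ideal. *)
Lemma transferMl H f f' :
  f \in invariants rG H -> transfer rG H (f * f') = f * transfer rG H f'.
Proof.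
move/invariantsP=> fP; rewrite /transfer mulr_sumr; apply: eq_bigr => h hH.
by rewrite rmorphM /= fP.
Qed.

End Transfer.

(** * The gluing, its kernel and its factors *)

Section GluingTransfer.
Variables (F : fieldType) (G1 G2 : finGroupType) (n1 n2 : nat).
Variables (r1 : mx_representation F [set: G1] n1).
Variables (r2 : mx_representation F [set: G2] n2).
Variable M : glue_module r1 r2.
Local Notation rV := (gluing_repr M).
Local Notation kerM := (gluing_kernel M).
Local Notation G12 := (gluing_factors M).
Implicit Types f : {mpoly F[n1 + n2]}.

HB.instance Definition _ := GRing.LRMorphism.copy (@mpolyl F n1 n2)
  (comp_mpoly [tuple 'X_(lshift n2 i) | i < n1]).
HB.instance Definition _ := GRing.LRMorphism.copy (@mpolyr F n1 n2)
  (comp_mpoly [tuple 'X_(rshift n1 i) | i < n2]).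

Lemma gluing_pair_factors g1 g2 : gluing_pair M g1 g2 \in G12.
Proof. by apply/imsetP; exists (g1, g2). Qed.

(** With [p] the pair having the outer components of [x], the product [x * p^-1] lies in the kernel.
    The sigma type lets [phi] be extracted, to define the inverse map of the bijection below. *)
Lemma gluing_kernel_factorsE (x : gluing M) :
  {phi : M | x = (Gluing 1 phi 1 * gluing_pair M (glue1 x) (glue2 x))%g}.
Proof.
set p := gluing_pair _ _ _; exists (glue_hom (x * p^-1)%g).
rewrite -[LHS](mulgKV p); congr (_ * _)%g.
by apply: gluing_eq; rewrite //= mulgV.
Qed.

Lemma gluing_kernel_factors_bij :
  bijective (fun t : G1 * G2 * M =>
    Gluing 1 t.2 1 * gluing_pair M t.1.1 t.1.2)%g.
Proof.
apply: (Bijective (g := fun x => (glue1 x, glue2 x,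
                                  sval (gluing_kernel_factorsE x)))).
  move=> [[g1 g2] phi] /=; case: gluing_kernel_factorsE => phi' /=.
  rewrite !mul1g => /mulIg /(congr1 (@glue_hom _ _ _ _ _ _ _ _)) /= <-.
  by [].
by move=> x /=; case: gluing_kernel_factorsE.
Qed.

Lemma transfer_kernelE f :
  transfer rV kerM f = \sum_(phi : M) mpact rV (Gluing 1 phi 1)%g f.
Proof.
by rewrite /transfer big_imset //= => phi phi' _ _ [].
Qed.

Lemma transfer_factorsE f :
  transfer rV G12 f
  = \sum_(g : G1 * G2) mpact rV (gluing_pair M g.1 g.2) f.
Proof.
by rewrite /transfer big_imset //= => [[g1 g2]] [g1' g2'] _ _ [] /= -> ->.
Qed.

(** The action is on the right, so in a product of a kernel element and a pair the kernel element
    acts first; hence the kernel transfer is the inner one. *)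
Lemma transfer_gluing f :
  transfer rV [set: gluing M] f = transfer rV G12 (transfer rV kerM f).
Proof.
rewrite transfer_factorsE transfer_kernelE /transfer.
under [RHS]eq_bigr do rewrite raddf_sum /=.
rewrite [LHS](eq_bigl predT); last by move=> x; rewrite inE.
rewrite pair_big (reindex _ (onW_bij _ gluing_kernel_factors_bij)) /=.
by apply: eq_bigr => t _; rewrite mpactM.
Qed.

Lemma invariants_gluing f :
  (f \in invariants rV [set: gluing M])
  = (f \in invariants rV kerM) && (f \in invariants rV G12).
Proof.
apply/invariantsP/andP=> [fP | [/invariantsP fK /invariantsP fP] x _].
  by split; apply/invariantsP => x _; apply: fP; rewrite inE.
have [phi ->] := gluing_kernel_factorsE x.
by rewrite mpactM fK ?fP ?gluing_pair_factors // imset_f.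
Qed.

(** Only for pairs: a nonzero upper right block would bring coordinates of W_2 into those of W_1. *)
Lemma mpact_gluing_pair_mpolyl g1 g2 (f : {mpoly F[n1]}) :
  mpact rV (gluing_pair M g1 g2) (mpolyl n2 f) = mpolyl n2 (mpact r1 g1 f).
Proof.
rewrite /mpact /mpolyl !comp_mpolyA; congr (_ \mPo _).
apply: eq_from_tnth => i; rewrite !tnth_mktuple comp_mpolyXU -tnth_nth.
rewrite tnth_mktuple raddf_sum big_split_ord /= [X in _ + X]big1 ?addr0.
  apply: eq_bigr => j _; rewrite block_mxEul comp_mpolyZ comp_mpolyXU.
  by rewrite -tnth_nth tnth_mktuple.
by move=> j _; rewrite block_mxEur mxE scale0r.
Qed.

(** Here any [x] is allowed, as the lower left block always vanishes: W_2 is a quotient of V. *)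
Lemma mpact_gluing_mpolyr (x : gluing M) (f : {mpoly F[n2]}) :
  mpact rV x (mpolyr n1 f) = mpolyr n1 (mpact r2 (glue2 x) f).
Proof.
rewrite /mpact /mpolyr !comp_mpolyA; congr (_ \mPo _).
apply: eq_from_tnth => i; rewrite !tnth_mktuple comp_mpolyXU -tnth_nth.
rewrite tnth_mktuple raddf_sum big_split_ord /= big1 ?add0r.
  apply: eq_bigr => j _; rewrite block_mxEdr comp_mpolyZ comp_mpolyXU.
  by rewrite -tnth_nth tnth_mktuple.
by move=> j _; rewrite block_mxEdl mxE scale0r.
Qed.

(** Monomials are pure tensors, which is all that is used of F[V] being spanned by F[W_1] and
    F[W_2]. *)
Lemma mpolyX_split (m : 'X_{1.. n1 + n2}) :
  'X_[m] = mpolyl n2 'X_[[multinom m (lshift n2 i) | i < n1]]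
         * mpolyr n1 'X_[[multinom m (rshift n1 i) | i < n2]]
  :> {mpoly F[n1 + n2]}.
Proof.
rewrite /mpolyl /mpolyr !comp_mpolyX mpolyXE_id big_split_ord /=.
by congr (_ * _); apply: eq_bigr => i _; rewrite tnth_mktuple mnmE.
Qed.

Lemma mpolyl_mpolyr_invariants (f1 : {mpoly F[n1]}) (f2 : {mpoly F[n2]}) :
  f1 \in invariants r1 [set: G1] -> f2 \in invariants r2 [set: G2] ->
  mpolyl n2 f1 * mpolyr n1 f2 \in invariants rV G12.
Proof.
move=> /invariantsP f1P /invariantsP f2P.
apply/invariantsP => _ /imsetP[g _ ->]; rewrite rmorphM /=.
by rewrite mpact_gluing_pair_mpolyl mpact_gluing_mpolyr f1P ?f2P ?inE.
Qed.

Lemma transfer_factors_mpolyl_mpolyr (f1 : {mpoly F[n1]}) (f2 : {mpoly F[n2]}) :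
  transfer rV G12 (mpolyl n2 f1 * mpolyr n1 f2)
  = mpolyl n2 (transfer r1 [set: G1] f1) * mpolyr n1 (transfer r2 [set: G2] f2).
Proof.
rewrite transfer_factorsE /transfer [mpolyl n2 (\sum_(_ in _) _)]raddf_sum.
rewrite [mpolyr n1 (\sum_(_ in _) _)]raddf_sum [RHS]big_distrlr pair_big /=.
apply: eq_big => [g | g _]; first by rewrite !inE.
by rewrite rmorphM /= mpact_gluing_pair_mpolyl mpact_gluing_mpolyr.
Qed.

Lemma transfer_factors_generates (I J : finType)
    (u : I -> {mpoly F[n1]}) (v : J -> {mpoly F[n2]}) :
  generates (invariants r1 [set: G1]) u (transfer_image r1 [set: G1]) ->
  generates (invariants r2 [set: G2]) v (transfer_image r2 [set: G2]) ->
  generates (invariants rV G12)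
    (fun ij : I * J => mpolyl n2 (u ij.1) * mpolyr n1 (v ij.2))
    (transfer_image rV G12).
Proof.
move=> u_gen v_gen; split=> [ij|f].
  by rewrite mpolyl_mpolyr_invariants ?(proj1 u_gen) ?(proj1 v_gen).
split=> [[{}f ->]|[a aP ->]]; last first.
  (* Each generator is the transfer of some [w ij], so an invariant combination of generators is the
     transfer of the same combination of the [w ij]. *)
  have /fin_all_exists[w wE] (ij : I * J) :
      transfer_image rV G12 (mpolyl n2 (u ij.1) * mpolyr n1 (v ij.2)).
    have [b ->] := generates_mem u_gen ij.1.
    have [c ->] := generates_mem v_gen ij.2.
    exists (mpolyl n2 b * mpolyr n1 c).
    by rewrite transfer_factors_mpolyl_mpolyr.
  exists (\sum_ij a ij * w ij); rewrite raddf_sum; apply: eq_bigr => ij _.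
  by rewrite wE /= transferMl.
(* Conversely, treat pure tensors first: the coefficients are products of those for the two
   factors. *)
have tensorP (f1 : {mpoly F[n1]}) (f2 : {mpoly F[n2]}) :
    exists2 a : I * J -> {mpoly F[n1 + n2]},
    (forall ij, a ij \in invariants rV G12) &
    transfer rV G12 (mpolyl n2 f1 * mpolyr n1 f2)
    = \sum_ij a ij * (mpolyl n2 (u ij.1) * mpolyr n1 (v ij.2)).
  have [b bP bE] := (proj2 u_gen (transfer r1 [set: G1] f1)).1
    (ex_intro _ _ erefl).
  have [c cP cE] := (proj2 v_gen (transfer r2 [set: G2] f2)).1
    (ex_intro _ _ erefl).
  exists (fun ij => mpolyl n2 (b ij.1) * mpolyr n1 (c ij.2)).
    by move=> ij; rewrite mpolyl_mpolyr_invariants.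
  rewrite transfer_factors_mpolyl_mpolyr bE cE !raddf_sum.
  rewrite [LHS]big_distrlr pair_big.
  by apply: eq_bigr => ij _; rewrite /= !rmorphM mulrACA.
(* Extend to all [f] by adding up over its monomials, the scalar [f@_m] being absorbed into the W_1
   factor. *)
rewrite (mpolyE f); elim/big_rec: _ => [|m f' _ [a aP aE]].
  exists (fun=> 0) => [ij|]; first exact: rpred0.
  by rewrite raddf0 big1 // => ij _; rewrite mul0r.
have [b bP bE] := tensorP (f@_m *: 'X_[[multinom m (lshift n2 i) | i < n1]])
  'X_[[multinom m (rshift n1 i) | i < n2]].
exists (fun ij => b ij + a ij) => [ij|]; first by rewrite rpredD.
rewrite raddfD /= aE mpolyX_split scalerAl -linearZ /= bE -big_split.
by apply: eq_bigr => ij _; rewrite mulrDl.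
Qed.

(** * Transport along the gluing isomorphism *)

Section Isomorphism.
Variable psi : {lrmorphism {mpoly F[n1 + n2]} -> {mpoly F[n1 + n2]}}.
Hypothesis psi_iso : gluing_isomorphism M psi.

(** Values of [psi] are already kernel invariant, so only invariance under the pairs matters;
    equivariance carries it forward and injectivity carries it back. *)
Lemma gluing_isomorphism_invariants f :
  (psi f \in invariants rV [set: gluing M]) = (f \in invariants rV G12).
Proof.
have -> : psi f \in invariants rV [set: gluing M]
        = (psi f \in invariants rV G12).
  rewrite invariants_gluing; suff -> : psi f \in invariants rV kerM by [].
  by apply/(gluing_iso_img psi_iso); exists f.
apply/invariantsP/invariantsP=> fP _ /imsetP[g _ ->].
  apply: (gluing_iso_inj psi_iso).
  by rewrite (gluing_iso_equivariant psi_iso) fP ?gluing_pair_factors.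
by rewrite -(gluing_iso_equivariant psi_iso) fP ?gluing_pair_factors.
Qed.

Lemma transfer_factors_gluing_isomorphism f :
  transfer rV G12 (psi f) = psi (transfer rV G12 f).
Proof.
rewrite !transfer_factorsE raddf_sum; apply: eq_bigr => g _.
by rewrite /= (gluing_iso_equivariant psi_iso).
Qed.

Lemma transfer_image_gluing tau f :
  tau \in invariants rV G12 ->
  generates (invariants rV kerM) (fun _ : 'I_1 => tau)
    (transfer_image rV kerM) ->
  transfer_image rV [set: gluing M] f <->
  exists2 b, transfer_image rV G12 b & f = tau * psi b.
Proof.
move=> tauP [_ tau_gen].
have transferE b : transfer rV G12 (psi b * tau)
                   = tau * psi (transfer rV G12 b).
  by rewrite mulrC transferMl // transfer_factors_gluing_isomorphism.
split=> [[{}f ->]|[_ [b ->] ->]].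
  (* The inner transfer is a multiple of [tau] by a kernel invariant, that is, by some [psi b]. *)
  have [a aP aE] := (tau_gen (transfer rV kerM f)).1 (ex_intro _ _ erefl).
  have [b bE] := (gluing_iso_img psi_iso (a ord0)).1 (aP ord0).
  exists (transfer rV G12 b); first by exists b.
  by rewrite transfer_gluing aE big_ord1 bE transferE.
(* Any [psi b * tau] is a kernel transfer of some [c], and [c] then has the required full
   transfer. *)
have [|c cE] := (tau_gen (psi b * tau)).2.
  exists (fun=> psi b); last by rewrite big_ord1.
  by move=> _; apply/(gluing_iso_img psi_iso); exists b.
by exists c; rewrite transfer_gluing -cE transferE.
Qed.

End Isomorphism.

End GluingTransfer.

Theorem proposition4p1
  (F : fieldType) (p : nat) (charF : p \in [pchar F])
  (G1 G2 : finGroupType) (n1 n2 : nat)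
  (r1 : mx_representation F [set: G1] n1)
  (r2 : mx_representation F [set: G2] n2)
  (M : glue_module r1 r2)
  (psi : {lrmorphism {mpoly F[n1 + n2]} -> {mpoly F[n1 + n2]}})
  (psi_iso : gluing_isomorphism M psi)
  (k : nat) (u : 'I_k -> {mpoly F[n1]})
  (u_gen : generates (invariants r1 [set: G1]) u (transfer_image r1 [set: G1]))
  (s : nat) (v : 'I_s -> {mpoly F[n2]})
  (v_gen : generates (invariants r2 [set: G2]) v (transfer_image r2 [set: G2]))
  (tau : {mpoly F[n1 + n2]})
  (tau_inv : tau \in invariants (gluing_repr M) (gluing_factors M))
  (tau_gen : generates (invariants (gluing_repr M) (gluing_kernel M))
               (fun _ : 'I_1 => tau)
               (transfer_image (gluing_repr M) (gluing_kernel M))) :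
  generates (invariants (gluing_repr M) [set: gluing M])
    (fun ij : 'I_k * 'I_s => tau * psi (mpolyl n2 (u ij.1) * mpolyr n1 (v ij.2)))
    (transfer_image (gluing_repr M) [set: gluing M]).
Proof.
have [w_inv w_gen] := transfer_factors_generates M u_gen v_gen.
have psiP := gluing_isomorphism_invariants psi_iso.
have tauG : tau \in invariants (gluing_repr M) [set: gluing M].
  by rewrite invariants_gluing tau_inv (proj1 tau_gen ord0).
split=> [ij|f]; first by rewrite rpredM // psiP w_inv.
rewrite (transfer_image_gluing psi_iso f tau_inv tau_gen).
split=> [[b /w_gen[a aP ->] ->] | [a aP ->]].
  exists (fun ij => psi (a ij)) => [ij|]; first by rewrite psiP.
  rewrite raddf_sum mulr_sumr; apply: eq_bigr => ij _.
  by rewrite /= rmorphM mulrCA.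
(* Coefficients invariant under the gluing are kernel invariant, hence values of [psi]; their
   preimages are invariant under the pairs by [psiP]. *)
have /fin_all_exists[c cE] (ij : 'I_k * 'I_s) : exists c, a ij = psi c.
  apply/(gluing_iso_img psi_iso).
  by move: (aP ij); rewrite invariants_gluing => /andP[].
exists (\sum_ij c ij * (mpolyl n2 (u ij.1) * mpolyr n1 (v ij.2))).
  by apply/w_gen; exists c => // ij; rewrite -psiP -cE.
rewrite raddf_sum mulr_sumr; apply: eq_bigr => ij _.
by rewrite cE mulrCA -rmorphM.
Qed.
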